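(* Let $m=4+12q$ with $q=6+8d$ for a nonnegative integer $d$. The minimal decomposition of $\mathbb{Z}_2$ for the Fibonacci polynomial $F_m$ is $$\mathbb{Z}_2=\{0\}\sqcup\Bigl(\bigcup_{k=0}^{2^4-1}M_k\Bigr)\sqcup(2\mathbb{Z}_2-\{0\}),$$ where $M_k=(1+4k+2^6\mathbb{Z}_2)\cup(19+20k+16k^2+2^6\mathbb{Z}_2)$. Here $\{0\}$ is the set of a fixed point, the $M_k$'s are the minimal components, and the set $2\mathbb{Z}_2-\{0\}$ is the attracting basin of the fixed point $0$.
   Context: $\mathbb{Z}_2$ is the ring of 2-adic integers with the 2-adic metric. The Fibonacci polynomials are defined by $F_0(x)=0$, $F_1(x)=1$, $F_m(x)=xF_{m-1}(x)+F_{m-2}(x)$ for $m\ge 2$. For a polynomial $f$ over $\mathbb{Z}_2$, a minimal decomposition of $\mathbb{Z}_2$ for $f$ is a decomposition $\mathbb{Z}_2=\mathcal P\sqcup\mathcal M\sqcup\mathcal B$ (some parts possibly empty) in which: $\mathcal P$ is the finite set consisting of all periodic points of $f$; $\mathcal M=\bigsqcup_i\mathcal M_i$ is the union of all (at most countably many) clopen $f$-invariant sets $\mathcal M_i$ (the minimal components), each a finite union of balls, such that each $f:\mathcal M_i\to\mathcal M_i$ is minimal (every orbit is dense in $\mathcal M_i$); and each point of $\mathcal B$ lies in the attracting basin of a periodic orbit or of a minimal subsystem. A point $x$ lies in the attracting basin of a set $C$ (a periodic orbit or minimal component) if the distance from $f^n(x)$ to $C$ tends to $0$ as $n\to\infty$;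 when a part $\mathcal B$ of a decomposition is said to be the attracting basin of $C$, this means every point of $\mathcal B$ lies in the attracting basin of $C$ (the points of $C$ being listed separately). *)

(* Defs.v *)
From HB Require Import structures.
From mathcomp Require Import all_boot all_order all_algebra.
From mathcomp Require Import all_classical all_reals all_analysis.

Set Implicit Arguments.
Unset Strict Implicit.
Unset Printing Implicit Defensive.

Import Order.TTheory GRing.Theory Num.Theory.
Import numFieldNormedType.Exports.

Local Open Scope classical_set_scope.
Local Open Scope ring_scope.

Local Notation rem2 z n := (modz z (2 ^+ n)).

(* The ring of 2-adic integers, as the inverse limit of the rings Z/2^n:       *)
(* [residue x n] is the representative of x mod 2^n in [0, 2^n), the bounds    *)
(* being a consequence of the coherence condition.                             *)
Record Z2 := MkZ2 {
  residue : nat -> int;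
  residue_coherent : forall n, residue n = rem2 (residue n.+1) n }.

HB.instance Definition _ := gen_eqMixin Z2.
HB.instance Definition _ := gen_choiceMixin Z2.

Lemma Z2P (x y : Z2) : (forall n, residue x n = residue y n) -> x = y.
Proof.
case: x y => [x cx] [y cy] /= /funext exy; subst y.
by rewrite (Prop_irrelevance cx cy).
Qed.

Lemma residue_mod (x : Z2) n : rem2 (residue x n) n = residue x n.
Proof. by rewrite residue_coherent modz_mod. Qed.

Lemma modz_exp2S (z : int) n :
  rem2 (rem2 z n.+1) n = rem2 z n.
Proof. by rewrite [in RHS](divz_eq z (2 ^+ n.+1)) exprS mulrA modzMDl. Qed.

Lemma Z2_of_int_subproof (z : int) n :
  rem2 z n = rem2 (rem2 z n.+1) n.
Proof. by rewrite modz_exp2S. Qed.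

Definition Z2_of_int (z : int) : Z2 := MkZ2 (Z2_of_int_subproof z).

Lemma Z2_opp_subproof (x : Z2) n :
  rem2 (- residue x n) n = rem2 (rem2 (- residue x n.+1) n.+1) n.
Proof. by rewrite modz_exp2S [residue x n]residue_coherent modzNm. Qed.

Definition Z2_opp (x : Z2) : Z2 := MkZ2 (Z2_opp_subproof x).

Lemma Z2_add_subproof (x y : Z2) n :
  rem2 (residue x n + residue y n) n =
  rem2 (rem2 (residue x n.+1 + residue y n.+1) n.+1) n.
Proof.
by rewrite modz_exp2S [residue x n]residue_coherent [residue y n]residue_coherent modzDm.
Qed.

Definition Z2_add (x y : Z2) : Z2 := MkZ2 (Z2_add_subproof x y).

Lemma Z2_mul_subproof (x y : Z2) n :
  rem2 (residue x n * residue y n) n =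
  rem2 (rem2 (residue x n.+1 * residue y n.+1) n.+1) n.
Proof.
by rewrite modz_exp2S [residue x n]residue_coherent [residue y n]residue_coherent modzMm.
Qed.

Definition Z2_mul (x y : Z2) : Z2 := MkZ2 (Z2_mul_subproof x y).

Lemma Z2_addA : associative Z2_add.
Proof. by move=> x y z; apply: Z2P => n /=; rewrite modzDml modzDmr addrA. Qed.

Lemma Z2_addC : commutative Z2_add.
Proof. by move=> x y; apply: Z2P => n /=; rewrite addrC. Qed.

Lemma Z2_add0 : left_id (Z2_of_int 0) Z2_add.
Proof. by move=> x; apply: Z2P => n /=; rewrite mod0z add0r residue_mod. Qed.

Lemma Z2_addN : left_inverse (Z2_of_int 0) Z2_opp Z2_add.
Proof. by move=> x; apply: Z2P => n /=; rewrite modzDml addNr. Qed.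

HB.instance Definition _ :=
  GRing.isZmodule.Build Z2 Z2_addA Z2_addC Z2_add0 Z2_addN.

Lemma Z2_mulA : associative Z2_mul.
Proof. by move=> x y z; apply: Z2P => n /=; rewrite modzMml modzMmr mulrA. Qed.

Lemma Z2_mulC : commutative Z2_mul.
Proof. by move=> x y; apply: Z2P => n /=; rewrite mulrC. Qed.

Lemma Z2_mul1 : left_id (Z2_of_int 1) Z2_mul.
Proof. by move=> x; apply: Z2P => n /=; rewrite modzMml mul1r residue_mod. Qed.

Lemma Z2_mulDl : left_distributive Z2_mul Z2_add.
Proof.
by move=> x y z; apply: Z2P => n /=; rewrite modzMml modzDm mulrDl.
Qed.

Lemma Z2_1neq0 : Z2_of_int 1 != 0 :> Z2.
Proof. by apply/eqP => /(congr1 (fun x : Z2 => residue x 1)). Qed.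

HB.instance Definition _ := GRing.Zmodule_isComNzRing.Build Z2
  Z2_mulA Z2_mulC Z2_mul1 Z2_mulDl Z2_1neq0.

Lemma residue0 n : residue 0 n = 0.
Proof. exact: mod0z. Qed.

Lemma residueB (x y : Z2) n :
  residue (x - y) n = rem2 (residue x n - residue y n) n.
Proof. by rewrite /= modzDmr. Qed.

Lemma residueB_eq0 (x y : Z2) n :
  (residue (x - y) n == 0) = (residue x n == residue y n).
Proof.
rewrite residueB -[in RHS](residue_mod x) -[in RHS](residue_mod y) eqz_mod_dvd.
exact/eqP/dvdz_mod0P.
Qed.

Lemma residue_le (x y : Z2) m n : (m <= n)%N ->
  residue x n = residue y n -> residue x m = residue y m.
Proof.
move=> /subnK <-; elim: (n - m)%N => [//|k IH]; rewrite addSn => e.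
by apply: IH; rewrite [LHS]residue_coherent [RHS]residue_coherent e.
Qed.

(* The 2-adic absolute value: 2^-v with v the largest n such that 2^n | x.     *)
Definition Z2_norm (R : realType) (x : Z2) : R :=
  if pselect (exists n, residue x n.+1 != 0) is left h
  then 2 ^- ex_minn h else 0.

Section Z2_metric.
Context {R : realType}.
Implicit Types x y z : Z2.

Lemma Z2_norm_ge0 x : 0 <= Z2_norm R x.
Proof. by rewrite /Z2_norm; case: pselect => // h; rewrite invr_ge0 exprn_ge0. Qed.

Lemma Z2_norm_le x n : (Z2_norm R x <= 2 ^- n) = (residue x n == 0).
Proof.
rewrite /Z2_norm; case: pselect => [h|h].
  case: ex_minnP => v vP vmin.
  rewrite lef_pV2 ?posrE ?exprn_gt0// ler_eXn2l ?ltr1n//.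
  apply/idP/eqP => [nv|xn].
    case: n nv => [|n] nv; first by rewrite residue_coherent expr0 modz1.
    apply/eqP/negPn/negP => /vmin; rewrite leqNgt => /negP; exact.
  rewrite leqNgt; apply/negP => vn; move/eqP: vP; apply.
  by rewrite -(residue0 v.+1); apply: residue_le vn _; rewrite xn residue0.
rewrite invr_ge0 exprn_ge0//; apply/esym/eqP.
move/forallNP : h => h; move/negP/negPn/eqP: (h n) => xn.
by rewrite residue_coherent xn mod0z.
Qed.

Lemma Z2_norm_eq0 x : Z2_norm R x = 0 -> x = 0.
Proof.
move=> x0; apply: Z2P => n; rewrite residue0; apply/eqP.
by rewrite -Z2_norm_le x0 invr_ge0 exprn_ge0.
Qed.

Lemma Z2_norm0 : Z2_norm R 0 = 0.
Proof.
rewrite /Z2_norm; case: pselect => // h; exfalso; case: h => n.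
by rewrite residue0 eqxx.
Qed.

Lemma Z2_norm_exp x : Z2_norm R x = 0 \/ exists n, Z2_norm R x = 2 ^- n.
Proof. by rewrite /Z2_norm; case: pselect => h; [right; eexists|left]. Qed.

Definition Z2_dist x y : R := Z2_norm R (x - y).

Lemma Z2_dist_le x y n : (Z2_dist x y <= 2 ^- n) = (residue x n == residue y n).
Proof. by rewrite /Z2_dist Z2_norm_le residueB_eq0. Qed.

Lemma Z2_distxx x : Z2_dist x x = 0.
Proof. by rewrite /Z2_dist subrr Z2_norm0. Qed.

Lemma Z2_dist_ge0 x y : 0 <= Z2_dist x y.
Proof. exact: Z2_norm_ge0. Qed.

Lemma Z2_dist_positivity x y : Z2_dist x y = 0 -> x = y.
Proof. by move/Z2_norm_eq0/eqP; rewrite subr_eq0 => /eqP. Qed.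

Lemma Z2_dist_exp x y : Z2_dist x y = 0 \/ exists n, Z2_dist x y = 2 ^- n.
Proof. exact: Z2_norm_exp. Qed.

Lemma Z2_dist_sym x y : Z2_dist x y = Z2_dist y x.
Proof.
have le a b : Z2_dist a b <= Z2_dist b a.
  have [/Z2_dist_positivity ->//|[n e]] := Z2_dist_exp b a.
  by rewrite e Z2_dist_le eq_sym -Z2_dist_le e.
by apply/eqP; rewrite eq_le !le.
Qed.

Lemma Z2_dist_ultra x y z :
  Z2_dist x z <= Num.max (Z2_dist x y) (Z2_dist y z).
Proof.
have [/Z2_dist_positivity ->|[m em]] := Z2_dist_exp x y.
  by rewrite le_max lexx orbT.
have [/Z2_dist_positivity ->|[n en]] := Z2_dist_exp y z.
  by rewrite le_max lexx.
have [mn|nm] := leqP m n.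
- rewrite le_max em Z2_dist_le; apply/orP; left; apply/eqP; transitivity (residue y m).
    by apply/eqP; rewrite -Z2_dist_le em.
  by apply: residue_le mn _; apply/eqP; rewrite -Z2_dist_le en.
- rewrite le_max en !Z2_dist_le; apply/orP; right; apply/eqP; transitivity (residue y n).
    by apply: residue_le (ltnW nm) _; apply/eqP; rewrite -Z2_dist_le em.
  by apply/eqP; rewrite -Z2_dist_le en.
Qed.

Definition Z2_ball x (e : R) : set Z2 := [set y | Z2_dist x y < e].

Lemma Z2_ball_center x (e : R) : 0 < e -> Z2_ball x e x.
Proof. by rewrite /Z2_ball/= Z2_distxx. Qed.

Lemma Z2_ball_sym x y (e : R) : Z2_ball x e y -> Z2_ball y e x.
Proof. by rewrite /Z2_ball/= Z2_dist_sym. Qed.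

Lemma Z2_ball_triangle x y z (e1 e2 : R) :
  Z2_ball x e1 y -> Z2_ball y e2 z -> Z2_ball x (e1 + e2) z.
Proof.
rewrite /Z2_ball/= => xy yz; apply: le_lt_trans (Z2_dist_ultra x y z) _.
rewrite gt_max (lt_le_trans xy) ?(lt_le_trans yz)//.
  by rewrite lerDr (le_trans (Z2_dist_ge0 _ _) (ltW xy)).
by rewrite lerDl (le_trans (Z2_dist_ge0 _ _) (ltW yz)).
Qed.

End Z2_metric.

Section Z2_uniform.
Local Open Scope relation_scope.

(* A description of the 2-adic uniformity that does not mention the reals; it  *)
(* is proved below to be the one of the 2-adic distance.                       *)
Definition Z2_ent : set_system (Z2 * Z2) :=
  filter_from [set: nat] (fun n => [set xy | residue xy.1 n = residue xy.2 n]).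

Lemma Z2_ent_filter : Filter Z2_ent.
Proof.
apply: filter_from_filter; first by exists 0%N.
move=> m n _ _; exists (maxn m n) => // -[x y] /= e.
by split; apply: residue_le e; rewrite ?leq_maxl ?leq_maxr.
Qed.

Lemma Z2_ent_diagonal A : Z2_ent A -> diagonal `<=` A.
Proof. by move=> [n _ nA] [x y] /= xy; apply: nA; rewrite /= -[y]xy. Qed.

Lemma Z2_ent_inv A : Z2_ent A -> Z2_ent A^-1.
Proof. by move=> [n _ nA]; exists n => // -[x y] /= xy; apply: nA => /=. Qed.

Lemma Z2_ent_split A : Z2_ent A -> exists2 B, Z2_ent B & B \; B `<=` A.
Proof.
move=> [n _ nA]; exists [set xy | residue xy.1 n = residue xy.2 n]; first by exists n.
by move=> [x y] [z /= xz zy]; apply: nA => /=; rewrite xz.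
Qed.

HB.instance Definition _ := isUniform.Build Z2
  Z2_ent_filter Z2_ent_diagonal Z2_ent_inv Z2_ent_split.

End Z2_uniform.

Lemma Z2_entourageE (R : realType) :
  (entourage : set_system (Z2 * Z2)) = entourage_ (@Z2_ball R).
Proof.
apply/seteqP; split => A.
- move=> [n _ nA]; exists (2 ^- n); first by rewrite /= invr_gt0 exprn_gt0.
  move=> [x y] /ltW; rewrite /= Z2_dist_le => /eqP xy; exact: (nA (x, y) xy).
- move=> [e /= e0 eA].
  have [n ne] : exists n, 2 ^- n < e.
    exists (Num.bound e^-1); rewrite invf_plt ?posrE ?exprn_gt0//.
    apply: lt_le_trans (archi_boundP _) _; first by rewrite invr_ge0 ltW.
    by rewrite -natrX ler_nat ltnW// ltn_expl.
  exists n => // -[x y] /= xy; apply: eA => /=; apply: le_lt_trans ne.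
  by rewrite Z2_dist_le; apply/eqP.
Qed.

HB.instance Definition _ (R : realType) := Uniform_isPseudoMetric.Build R Z2
  (@Z2_ball_center R) (@Z2_ball_sym R) (@Z2_ball_triangle R) (Z2_entourageE R).

Lemma Z2_ballE (R : realType) (x : Z2) (d : R) :
  ball x d = [set y | Z2_dist x y < d].
Proof. by []. Qed.

HB.instance Definition _ (R : realType) := PseudoMetric_isMetric.Build R Z2
  (@Z2_dist_ge0 R) (@Z2_dist_positivity R) (@Z2_ballE R).

Fixpoint fibpoly (A : nzRingType) (m : nat) : {poly A} :=
  match m with
  | 0 => 0
  | m1.+1 =>
    match m1 with
    | 0 => 1
    | m2.+1 => 'X * fibpoly A m1 + fibpoly A m2
    end
  end.

Section orbits.
Context (T : Type) (f : T -> T).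
Implicit Types (x : T) (C : set T).

Definition periodic_point x := exists2 n, (0 < n)%N & iter n f x = x.

Definition forward_orbit x : set T := range (fun n => iter n f x).

Definition periodic_orbit C :=
  exists2 x, periodic_point x & C = forward_orbit x.

End orbits.

Section metric_dynamics.
Context (R : realType) (T : metricType R) (f : T -> T).
Implicit Types (x : T) (C : set T).

Definition finite_union_of_balls C :=
  exists (n : nat) (c : 'I_n -> T) (r : 'I_n -> R),
    (forall i, 0 < r i) /\ C = \bigcup_i ball (c i) (r i).

(* As C is invariant, the orbit of a point x of C is dense in C for the        *)
(* topology induced on C iff C is contained in its closure in T.               *)
Definition minimal_component C :=
  [/\ C !=set0,
      clopen C,
      finite_union_of_balls C,
      f @` C `<=` C &
      forall x, C x -> C `<=` closure (forward_orbit f x)].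

Definition dist_to_set C x : R := inf [set mdist x y | y in C].

Definition attracting_basin C : set T :=
  [set x | dist_to_set C (iter n f x) @[n --> \oo] --> (0 : R)].

End metric_dynamics.

Arguments minimal_component R {T} f C.
Arguments attracting_basin R {T} f C.

(* [M] enumerates the minimal components along the index set [D], which may be *)
(* empty; by [trivIset] distinct indices give disjoint components.             *)
Definition minimal_decomposition (R : realType) (p : {poly Z2})
    (P : set Z2) (I : Type) (D : set I) (M : I -> set Z2) (B : set Z2) : Prop :=
  let f : Z2 -> Z2 := horner p in
  let MM := \bigcup_(i in D) M i in
  [/\ [/\ [set: Z2] = P `|` MM `|` B,
          P `&` MM = set0, P `&` B = set0 & MM `&` B = set0],
      finite_set P /\ P = [set x | periodic_point f x],
      countable D /\ trivIset D M,
      forall C : set Z2,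
        minimal_component R f C <-> (exists2 i, D i & C = M i) &
      forall x, B x -> exists2 C : set Z2,
        periodic_orbit f C \/ minimal_component R f C &
        attracting_basin R f C x].

(* a + 2^n Z_2 *)
Definition coset2 (a : Z2) (n : nat) : set Z2 := [set a + 2 ^+ n * z | z in setT].

(* Main.v *)
From Stdlib Require Import NArith.
Require Import Defs.
From mathcomp Require Import all_boot all_order all_algebra.
From mathcomp Require Import all_classical all_reals all_analysis.
From mathcomp Require Import ring.

(** Write F for the polynomial map of F_m; here m = 76 + 96 d, so m is even
    and m = 4 modulo 12.

    On even points F is a contraction: since F_(2n)(x) = x (n + x w)
    ([fib_even]) and n = m/2 is even, F x is a multiple of 2 x, so the n-th
    iterate of F at x vanishes modulo 2^n.  Hence 0 attracts every even point,
    and 0 is the only even periodic point.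

    On odd points the second iterate h of F behaves like the odometer
    x |-> x + 2^6.  Two facts of bounded precision suffice for this:
    - h x = x + 64 modulo 128 ([fib_fib_mod128]);
    - h y - h x = (y - x) (1 + 4 w) as soon as y = x modulo 64
      ([h_isometry]), which by Taylor expansion only says that the derivative
      of F_m is 1 modulo 4 on odd points ([deriv_fib_mod4]).
    Doubling the number of iterations then doubles the translation: if
    H x - x = 2^N (1 + 2 u) and H is such an isometry, then
    H (H x) - x = (H x - x) (2 + 4 w) = 2^(N+1) (1 + 2 u) (1 + 2 w).
    So the 2^n-th iterate of h moves x by 2^(6+n) modulo 2^(7+n)
    ([odometer_pow2]).  Choosing binary digits one at a time shows that the
    h-orbit of x is dense in x + 2^6 Z_2 ([odometer_dense]), and comparing
    2-adic valuations shows that it is never periodic ([odometer_aperiodic]).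

    Both facts are finite computations: modulo 2^k the value F_m(x) depends
    only on the residue of x, and for odd x the sequence n |-> F_n(x) has
    period 192 modulo 128, 96 modulo 64, and n |-> (F_n(x), F_n'(x)) has period
    12 modulo 4.  A last computation modulo 64 shows that F exchanges the two
    cosets that form M_k, so that F-orbits are dense in M_k, and that the M_k
    partition the odd integers.

    Conversely a minimal component C is the closure of the orbit of any of its
    points ([minimal_component_closure]).  If C has an odd point, C is one of
    the M_k; if it has an even point, the orbit tends to 0, so that 0 is in C
    and C is the closure of the orbit of 0, that is {0}, which is not open. *)

Import Order.TTheory GRing.Theory Num.Theory.

Local Open Scope classical_set_scope.
Local Open Scope ring_scope.

Set Implicit Arguments.
Unset Strict Implicit.
Unset Printing Implicit Defensive.

(** * Congruences modulo powers of 2 in Z_2 *)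

Lemma pow2Z_gt0 n : (0 : int) < 2 ^+ n. Proof. exact: exprn_gt0. Qed.

Lemma residue_nat (k n : nat) : residue k%:R n = modz k (2 ^+ n).
Proof.
elim: k => [|k IH]; first by rewrite residue0 mod0z.
by rewrite -natr1 /= IH modzDm -PoszD addn1.
Qed.

Lemma residue_trunc x m n : (m <= n)%N ->
  residue x m = modz (residue x n) (2 ^+ m).
Proof.
move=> mn; suff: residue (Z2_of_int (residue x n)) m = residue x m by move=> <-.
by apply: residue_le mn _; rewrite /= residue_mod.
Qed.

Lemma residue_ge0 x n : 0 <= residue x n.
Proof. by rewrite -residue_mod modz_ge0 // expf_neq0. Qed.

Lemma residue_lt x n : residue x n < 2 ^+ n.
Proof. by rewrite -residue_mod ltz_pmod ?pow2Z_gt0. Qed.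

Lemma pow2E n : 2 ^+ n = (2 ^ n)%N :> int.
Proof. by rewrite -[RHS]natz natrX. Qed.

Definition cong n (x y : Z2) := residue x n = residue y n.

(** Dropping the [n] lowest digits of a coherent sequence leaves a coherent one;
    this is the quotient that witnesses divisibility by [2 ^+ n] in [congP]. *)
Lemma Z2_quo_subproof (x : Z2) (n k : nat) :
  divz (residue x (n + k)) (2 ^+ n) =
  modz (divz (residue x (n + k.+1)) (2 ^+ n)) (2 ^+ k).
Proof.
rewrite (@residue_trunc x (n + k) (n + k.+1)) ?addnS //.
set z := residue x _.
have n0 : (2 ^+ n : int) != 0 by rewrite expf_neq0.
have k0 : (2 ^+ k : int) != 0 by rewrite expf_neq0.
rewrite {2}(divz_eq z (2 ^+ (n + k))) exprD.
rewrite [2 ^+ n * _]mulrC mulrA divzMDl // modzMDl [RHS]modz_small //.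
rewrite divz_ge0 ?pow2Z_gt0 // modz_ge0 ?mulf_neq0 //=.
by rewrite ltz_divLR ?pow2Z_gt0 // ltz_pmod // mulr_gt0 ?pow2Z_gt0.
Qed.

Definition Z2_quo (n : nat) (x : Z2) : Z2 := MkZ2 (Z2_quo_subproof x n).

(** Turns equality of residues into an equation of the ring, to which [ring]
    applies; the witness is the shifted digit expansion of [x - y]. *)
Lemma congP n x y : cong n x y <-> exists w, x = y + 2 ^+ n * w.
Proof.
have pE k : residue (2 ^+ n) k = modz (2 ^+ n) (2 ^+ k).
  by rewrite -natrX residue_nat -natz natrX.
split=> [xy|[w ->]]; last first.
  by rewrite /cong /= pE modzz mul0r mod0z addr0 residue_mod.
have z0 : residue (x - y) n = 0 by apply/eqP; rewrite residueB_eq0 xy.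
suff E : x - y = 2 ^+ n * Z2_quo n (x - y).
  by exists (Z2_quo n (x - y)); rewrite -E addrC subrK.
apply: Z2P => k; move: (x - y) z0 => z z0 /=; rewrite pE modzMml mulrC divzK.
  by rewrite -residue_trunc ?leq_addl.
apply/dvdz_mod0P; rewrite -residue_trunc ?leq_addr //.
Qed.

Lemma congD n x y x' y' : cong n x y -> cong n x' y' -> cong n (x + x') (y + y').
Proof. by rewrite /cong /= => -> ->. Qed.

Lemma congM n x y x' y' : cong n x y -> cong n x' y' -> cong n (x * x') (y * y').
Proof. by rewrite /cong /= => -> ->. Qed.

Lemma cong_refl n x : cong n x x. Proof. by []. Qed.

Lemma cong_sym n x y : cong n x y -> cong n y x. Proof. exact: esym. Qed.

Lemma cong_trans n y x z : cong n x y -> cong n y z -> cong n x z.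
Proof. exact: etrans. Qed.

Lemma cong_le m n x y : (m <= n)%N -> cong n x y -> cong m x y.
Proof. exact: residue_le. Qed.

Lemma cong_nat n (i j : nat) :
  cong n i%:R j%:R <-> i = j %[mod 2 ^ n].
Proof.
rewrite /cong !residue_nat pow2E !modz_nat.
by split=> [[]|->].
Qed.

Lemma cong_natE n x : exists2 r : nat, (r < 2 ^ n)%N & cong n x r%:R.
Proof.
have := residue_ge0 x n; have := residue_lt x n.
rewrite pow2E => xlt xge.
exists `|residue x n|%N.
  by rewrite -ltz_nat gez0_abs.
by rewrite /cong residue_nat gez0_abs // residue_mod.
Qed.

Lemma cong_shift n x : cong n (x + 2 ^+ n) x.
Proof. by apply/congP; exists 1; rewrite mulr1. Qed.

Lemma cong_succ n x y : cong n y x -> cong n.+1 y x \/ cong n.+1 y (x + 2 ^+ n).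
Proof.
case/congP => w ->; have [[|[|//]] _ /congP[v ->]] := cong_natE 1 w; [left|right].
  by apply/congP; exists v; rewrite [2 ^+ n.+1]exprSr expr1; ring.
by apply/congP; exists v; rewrite [2 ^+ n.+1]exprSr expr1; ring.
Qed.

Definition odd2 (x : Z2) := cong 1 x 1.

Lemma odd2_nat (r : nat) : odd2 r%:R <-> odd r.
Proof.
rewrite /odd2 -[1]/(1%:R) cong_nat expn1 !modn2.
by split=> [/eqP|->//]; case: (odd r).
Qed.

Lemma cong_odd2 n x y : cong n.+1 x y -> odd2 y -> odd2 x.
Proof. by move=> xy oy; apply: cong_trans oy; apply: cong_le xy. Qed.

Lemma even_or_odd x : cong 1 x 0 \/ odd2 x.
Proof. by have [[|[|//]] _ xr] := cong_natE 1 x; [left|right]. Qed.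

(** * Polynomial maps *)

(** The second-order remainder is what makes the derivative of a polynomial
    modulo 4 control its difference quotients at points that agree modulo 4. *)
Lemma horner_taylor2 (A : comNzRingType) (p : {poly A}) (x y : A) :
  exists w, p.[y] = p.[x] + (y - x) * p^`().[x] + (y - x) ^+ 2 * w.
Proof.
elim/poly_ind: p => [|p c [w IH]]; first by exists 0; rewrite deriv0 !horner0; ring.
exists (w * x + p^`().[x] + (y - x) * w).
rewrite !hornerE derivD derivM derivX derivC !hornerE IH; ring.
Qed.

Lemma cong_horner n (p : {poly Z2}) x y : cong n x y -> cong n p.[x] p.[y].
Proof.
move=> xy; elim/poly_ind: p => [|p c IH]; first by rewrite !horner0.
by rewrite !hornerE; apply: congD => //; apply: congM.
Qed.

(** * Fibonacci polynomials *)

Lemma fibpoly0 A : fibpoly A 0 = 0. Proof. by []. Qed.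

Lemma fibpoly1 A : fibpoly A 1 = 1. Proof. by []. Qed.

Lemma fibpolySS A n : fibpoly A n.+2 = 'X * fibpoly A n.+1 + fibpoly A n.
Proof. by []. Qed.

(* Unfolding [fibpoly] takes exponential time in the index. *)
Local Opaque fibpoly.

Section Fib.
Variable A : comNzRingType.
Notation F := (fibpoly A).

Lemma fibSS n x : (F n.+2).[x] = x * (F n.+1).[x] + (F n).[x].
Proof. by rewrite fibpolySS !hornerE. Qed.

Lemma deriv_fibSS n x :
  (F n.+2)^`().[x] = (F n.+1).[x] + x * (F n.+1)^`().[x] + (F n)^`().[x].
Proof. by rewrite fibpolySS derivD derivM derivX !hornerE. Qed.

(** The two lowest coefficients of F_(2n) are 0 and n; the induction also needs
    that the constant coefficient of F_(2n+1) is 1. *)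
Lemma fib_even n x : exists w, (F n.*2).[x] = x * (n%:R + x * w).
Proof.
suff [w [v [-> _]]] : exists w v, (F n.*2).[x] = x * (n%:R + x * w) /\
    (F n.*2.+1).[x] = 1 + x * v by exists w.
elim: n => [|n [w [v [IH0 IH1]]]].
  by exists 0, 0; rewrite fibpoly0 fibpoly1 horner0 hornerC; split; ring.
rewrite doubleS; exists (w + v), (x * (1 + x * v) + x * (n%:R + x * w) + v).
by rewrite [(F n.*2.+3).[x]]fibSS fibSS IH0 IH1 -natr1; split; ring.
Qed.
End Fib.

(** The recursion is determined by two consecutive values, so returning to the
    initial values 0, 1 modulo [2 ^+ k] at index [P] makes [P] a period. *)
Lemma fib_period k P x : cong k (fibpoly Z2 P).[x] 0 ->
  cong k (fibpoly Z2 P.+1).[x] 1 ->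
  forall n j, cong k (fibpoly Z2 (n + P * j)).[x] (fibpoly Z2 n).[x].
Proof.
move=> F0 F1 n j; elim: j => [|j IH]; first by rewrite muln0 addn0.
apply: cong_trans IH; rewrite mulnS addnCA addnC; move: (n + P * j)%N => {}n.
suff []: cong k (fibpoly Z2 (n + P)).[x] (fibpoly Z2 n).[x] /\
  cong k (fibpoly Z2 (n + P).+1).[x] (fibpoly Z2 n.+1).[x] by [].
elim: n => [|n [IH0 IH1]]; first by rewrite add0n fibpoly0 fibpoly1 horner0 hornerC.
by rewrite addSn; split=> //; rewrite !fibSS; apply: congD => //; apply: congM.
Qed.

Lemma deriv_fib_period k P x : cong k (fibpoly Z2 P).[x] 0 ->
  cong k (fibpoly Z2 P.+1).[x] 1 ->
  cong k (fibpoly Z2 P)^`().[x] 0 ->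
  cong k (fibpoly Z2 P.+1)^`().[x] 0 ->
  forall n j, cong k (fibpoly Z2 (n + P * j))^`().[x] (fibpoly Z2 n)^`().[x].
Proof.
move=> F0 F1 D0 D1 n j; elim: j => [|j IH]; first by rewrite muln0 addn0.
apply: cong_trans IH; rewrite mulnS addnCA addnC; move: (n + P * j)%N => {}n.
suff []: cong k (fibpoly Z2 (n + P))^`().[x] (fibpoly Z2 n)^`().[x] /\
  cong k (fibpoly Z2 (n + P).+1)^`().[x] (fibpoly Z2 n.+1)^`().[x] by [].
elim: n => [|n [IH0 IH1]].
  by rewrite add0n fibpoly0 fibpoly1 deriv0 derivC horner0.
rewrite addSn; split=> //; rewrite !deriv_fibSS; apply: congD => //.
apply: congD; last exact: congM.
by have := fib_period F0 F1 n.+1 1; rewrite muln1 addSn.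
Qed.

(** * Computation of F_n and F_n' on residues *)

Lemma to_natD a b : N.to_nat (N.add a b) = (N.to_nat a + N.to_nat b)%N.
Proof. exact: N2Nat.inj_add. Qed.

Lemma to_natM a b : N.to_nat (N.mul a b) = (N.to_nat a * N.to_nat b)%N.
Proof. exact: N2Nat.inj_mul. Qed.

(** A state [(a, b, (a', b'))] stands for F_n(x), F_(n+1)(x), F_n'(x) and
    F_(n+1)'(x) reduced modulo [M]; binary numbers keep the computation fast. *)
Definition fib_step (M x : N) (s : N * N * (N * N)) :=
  let: (a, b, (a', b')) := s in
  (b, N.modulo (N.add (N.mul x b) a) M,
   (b', N.modulo (N.add (N.add b (N.mul x b')) a') M)).

Definition fib_mod (M : N) (n : nat) (x : N) : N * N * (N * N) :=
  iter n (fib_step M x) (0, 1, (0, 0))%num.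

Local Notation "n %:Z2" := (N.to_nat n)%:R (at level 2, only parsing).

Lemma cong_modN k (M a : N) : N.to_nat M = (2 ^ k)%N ->
  cong k a%:Z2 (N.modulo a M)%:Z2.
Proof.
move=> hM; apply/congP; exists (N.div a M)%:Z2.
rewrite {1}(N.div_mod' a M) to_natD to_natM hM.
by rewrite natrD natrM natrX addrC.
Qed.

Definition fib_tracks k n (x : Z2) (s : N * N * (N * N)) : Prop :=
  let: (a, b, (a', b')) := s in
  [/\ cong k (fibpoly Z2 n).[x] a%:Z2,
      cong k (fibpoly Z2 n.+1).[x] b%:Z2,
      cong k (fibpoly Z2 n)^`().[x] a'%:Z2 &
      cong k (fibpoly Z2 n.+1)^`().[x] b'%:Z2].

Lemma fib_modP k (M : N) n (x : Z2) (r : N) :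
  N.to_nat M = (2 ^ k)%N -> cong k x r%:Z2 ->
  fib_tracks k n x (fib_mod M n r).
Proof.
move=> hM xr; elim: n => [|n].
  by rewrite /= fibpoly0 fibpoly1 horner0 hornerC deriv0 derivC horner0.
rewrite /fib_mod iterS -/(fib_mod M n r).
case: (fib_mod M n r) => [[a b] [a' b']] [IHa IHb IHa' IHb'].
split=> //.
- apply: cong_trans (cong_modN _ hM); rewrite fibSS to_natD to_natM.
  by rewrite natrD natrM; apply: congD => //; apply: congM.
- apply: cong_trans (cong_modN _ hM); rewrite deriv_fibSS !to_natD.
  rewrite to_natM !natrD natrM; apply: congD => //.
  by apply: congD => //; apply: congM.
Qed.

Definition odd_residues (k : nat) := [seq N.of_nat r | r <- iota 0 (2 ^ k) & odd r].

Lemma odd2_residue k (x : Z2) : (0 < k)%N -> odd2 x ->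
  exists2 r, r \in odd_residues k & cong k x r%:Z2.
Proof.
move=> k0 ox; have [r rk xr] := cong_natE k x.
exists (N.of_nat r); last by rewrite Nat2N.id.
apply: map_f; rewrite mem_filter mem_iota /= rk andbT.
by apply/odd2_nat; apply: cong_trans ox; apply: cong_le _ (cong_sym xr).
Qed.

(** Reduces a property of the values of F_n and its derivative at all odd
    2-adic integers to a computation over the odd residues modulo 2^k. *)
Lemma fib_odd_residues k (M : N) (n : nat) (P : pred (N * N * (N * N))) :
  N.to_nat M = (2 ^ k)%N -> (0 < k)%N ->
  all (fun r => P (fib_mod M n r)) (odd_residues k) ->
  forall x, odd2 x -> exists2 s, P s & fib_tracks k n x s.
Proof.
move=> hM k0 /allP chk x /(odd2_residue k0)[r rk xr].
by exists (fib_mod M n r); [apply: chk|apply: fib_modP].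
Qed.

Lemma fib192_mod128 x : odd2 x ->
  cong 7 (fibpoly Z2 192).[x] 0 /\ cong 7 (fibpoly Z2 193).[x] 1.
Proof.
case/(@fib_odd_residues 7 128 192 (fun s => s.1 == (0, 1)%num) erefl erefl).
  by vm_compute.
by case=> [[a b] [a' b']] /eqP[-> ->] [].
Qed.

Lemma fib96_mod64 x : odd2 x ->
  cong 6 (fibpoly Z2 96).[x] 0 /\ cong 6 (fibpoly Z2 97).[x] 1.
Proof.
case/(@fib_odd_residues 6 64 96 (fun s => s.1 == (0, 1)%num) erefl erefl).
  by vm_compute.
by case=> [[a b] [a' b']] /eqP[-> ->] [].
Qed.

Lemma fib3_mod2 x : odd2 x ->
  cong 1 (fibpoly Z2 3).[x] 0 /\ cong 1 (fibpoly Z2 4).[x] 1.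
Proof.
case/(@fib_odd_residues 1 2 3 (fun s => s.1 == (0, 1)%num) erefl erefl).
  by vm_compute.
by case=> [[a b] [a' b']] /eqP[-> ->] [].
Qed.

(** By periodicity modulo 4 this is the case of F_4 = X^3 + 2 X, whose
    derivative 3 X^2 + 2 is 5 modulo 8 at odd points. *)
Lemma deriv_fib_mod4 x j : odd2 x -> cong 2 (fibpoly Z2 (4 + 12 * j))^`().[x] 1.
Proof.
move=> ox; apply: (@cong_trans _ (fibpoly Z2 4)^`().[x]).
  have := @fib_odd_residues 2 4 12 (fun s => s == (0, 1, (0, 0))%num) erefl erefl.
  case/(_ _ _ ox); first by vm_compute.
  by case=> [[a b] [a' b']] /eqP[-> -> -> ->] [F0 F1 D0 D1]; apply: deriv_fib_period.
have := @fib_odd_residues 2 4 4 (fun s => s.2.1 == 1%num) erefl erefl.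
case/(_ _ _ ox); first by vm_compute.
by case=> [[a b] [a' b']] /eqP/= -> [].
Qed.

(** The period 192 leaves the two indices 76 and 172.  In each case the
    computation is done on residues modulo 128, for the values of F as well as
    for its arguments. *)
Lemma fib_fib_mod128 d x : odd2 x ->
  cong 7 (fibpoly Z2 (76 + 96 * d)).[(fibpoly Z2 (76 + 96 * d)).[x]] (x + 2 ^+ 6).
Proof.
move=> ox.
have [n [j [hn ->]]] : exists n j, (n = 76 \/ n = 172) /\
    (76 + 96 * d = n + 192 * j)%N.
  exists (if odd d then 172 else 76)%N, d./2.
  split; first by case: odd; [right|left].
  rewrite -[in LHS](odd_double_half d) -mul2n mulnDr mulnA.
  by case: odd; rewrite /= addnA.
have [F0 F1] := fib192_mod128 ox; have E := fib_period F0 F1 n j.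
have chk : all (fun r => let a := (fib_mod 128 n r).1.1 in
      ((fib_mod 128 n a).1.1 == N.modulo (N.add r 64) 128) && odd (N.to_nat a))
    (odd_residues 7).
  by case: hn => ->; vm_compute.
have [r rk xr] := @odd2_residue 7 x erefl ox.
move/allP/(_ r rk): chk; move: (@fib_modP 7 128 n x r erefl xr).
case: fib_mod => [[a b] [a' b']] [xa _ _ _] /= /andP[/eqP ha oa].
have Fa := cong_trans E xa; set y := _.[x] in Fa *.
have oy : odd2 y by exact: cong_odd2 Fa ((odd2_nat _).2 oa).
have [G0 G1] := fib192_mod128 oy; apply: cong_trans (fib_period G0 G1 n j) _.
move: (@fib_modP 7 128 n y a erefl Fa) ha.
case: fib_mod => [[{}b c] [{}b' c']] [ya _ _ _] /= ha.
apply: cong_trans ya _; rewrite ha.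
apply: cong_trans (cong_sym (@cong_modN 7 128 _ erefl)) _.
rewrite to_natD natrD (_ : N.to_nat 64 = 2 ^ 6)%N // natrX.
by apply: congD => //; apply: cong_sym.
Qed.

(** Representatives of the two cosets of 2^6 Z_2 that form M_k; the first one is
    1 modulo 4, the second one 3 modulo 4. *)
Definition rep1 (k : nat) : nat := 1 + 4 * k.
Definition rep3 (k : nat) : nat := 19 + 20 * k + 16 * k ^ 2.

Lemma odd_rep1 k : odd (rep1 k).
Proof. by rewrite /rep1 oddD (oddM 4). Qed.

Lemma odd_rep3 k : odd (rep3 k).
Proof. by rewrite /rep3 oddD (oddD 19) (oddM 20) (oddM 16). Qed.

Definition fib76_maps (i j : nat) : bool :=
  N.modulo (fib_mod 64 76 (N.of_nat i)).1.1 64 == N.modulo (N.of_nat j) 64.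

(** F exchanges the two cosets of M_k.  Modulo 64 the period is 96, so only the
    index 76 has to be computed. *)
Lemma fib_mod64 d (k : nat) : (k < 16)%N ->
  (forall x, cong 6 x (rep1 k)%:R ->
    cong 6 (fibpoly Z2 (76 + 96 * d)).[x] (rep3 k)%:R) /\
  (forall x, cong 6 x (rep3 k)%:R ->
    cong 6 (fibpoly Z2 (76 + 96 * d)).[x] (rep1 k)%:R).
Proof.
move=> k16.
have red i j : odd i ->
    fib76_maps i j ->
    forall x, cong 6 x i%:R -> cong 6 (fibpoly Z2 (76 + 96 * d)).[x] j%:R.
  move=> oi hij x xi.
  have ox : odd2 x by exact: cong_odd2 xi ((odd2_nat i).2 oi).
  have [F0 F1] := fib96_mod64 ox; apply: cong_trans (fib_period F0 F1 76 d) _.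
  rewrite -[i]Nat2N.id in xi.
  move: hij; rewrite /fib76_maps; move: (@fib_modP 6 64 76 x _ erefl xi).
  case: fib_mod => [[u v] [u' v']] [xu _ _ _] /eqP hij.
  apply: cong_trans xu _; apply: cong_trans (@cong_modN 6 64 _ erefl) _.
  rewrite hij; apply: cong_trans (cong_sym (@cong_modN 6 64 _ erefl)) _.
  by rewrite Nat2N.id.
have chk : all (fun k => fib76_maps (rep1 k) (rep3 k) &&
    fib76_maps (rep3 k) (rep1 k)) (iota 0 16).
  by vm_compute.
move/allP/(_ k): chk; rewrite mem_iota => /(_ k16)/andP[ab ba].
by split; [exact: (red _ _ (odd_rep1 k) ab)|exact: (red _ _ (odd_rep3 k) ba)].
Qed.

(** * Odometers *)

(** [h] translates by [2 ^+ k] modulo [2 ^+ k.+1] and is an isometry up to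
    factors in 1 + 4 Z_2.  Factors in 1 + 2 Z_2 would be too weak: doubling the
    number of steps would multiply translations by 2 + 2 w, which may be
    divisible by 4. *)
Section Odometer.
Variables (h : Z2 -> Z2) (k : nat) (S : set Z2).
Hypothesis S_sat : forall x y, S x -> cong k y x -> S y.
Hypothesis h_shift : forall x, S x -> cong k.+1 (h x) (x + 2 ^+ k).
Hypothesis h_isom : forall x y, S x -> cong k y x ->
  exists w, h y - h x = (y - x) * (1 + 4 * w).

(** Iterating twice multiplies the translation by 2 + 4 w, which is 2 times a
    unit, and the factors 1 + 4 w are closed under products. *)
Lemma odometer_pow2 n :
  (forall x, S x -> cong (k + n).+1 (iter (2 ^ n) h x) (x + 2 ^+ (k + n))) /\
  (forall x y, S x -> cong k y x ->
    exists w, iter (2 ^ n) h y - iter (2 ^ n) h x = (y - x) * (1 + 4 * w)).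
Proof.
elim: n => [|n]; first by rewrite addn0; split.
rewrite expnS mul2n -addnn; set H := iter (2 ^ n) h => -[shiftH isomH].
have HS x : S x -> cong k (H x) x.
  move=> Sx; apply: cong_le (leq_addr n k) _.
  by apply: cong_trans (cong_le _ (shiftH x Sx)) (cong_shift _ _).
split=> [x Sx|x y Sx yx]; rewrite !iterD -/H.
  have [u Hx] := (congP _ _ _).1 (shiftH x Sx).
  have [w HHx] := isomH x (H x) Sx (HS x Sx).
  apply/congP; exists (u + w + 2 * u * w).
  rewrite -[LHS](subrK (H x)) HHx Hx addnS !exprS; ring.
have [w Hyx] := isomH x y Sx yx.
have HyHx : cong k (H y) (H x).
  by apply: cong_trans (HS y (S_sat Sx yx)) (cong_trans yx (cong_sym (HS x Sx))).
have [v ->] := isomH (H x) (H y) (S_sat Sx (HS x Sx)) HyHx.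
by exists (w + v + 4 * w * v); rewrite Hyx; ring.
Qed.

Lemma odometer_iter_sat n x : S x -> cong k (iter n h x) x.
Proof.
move=> Sx; elim: n => [|n IH]; first exact: cong_refl.
have Sn := S_sat Sx IH; rewrite iterS; apply: cong_trans IH.
by apply: cong_trans (cong_le _ (h_shift Sn)) (cong_shift _ _).
Qed.

(** If the orbit agrees with [y] on [k + n] binary digits but not on the next
    one, [2 ^ n] more steps correct that digit. *)
Lemma odometer_dense n x y : S x -> cong k y x ->
  exists j, cong (k + n) (iter j h x) y.
Proof.
move=> Sx yx; elim: n => [|n [j IH]].
  by exists 0%N; rewrite addn0; apply: cong_sym.
rewrite addnS; case: (cong_succ (cong_sym IH)) => {}IH.
  by exists j; apply: cong_sym.
exists (2 ^ n + j)%N; rewrite iterD; apply: cong_trans (cong_sym IH).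
by apply: (odometer_pow2 n).1; apply: S_sat (odometer_iter_sat _ Sx).
Qed.

(** For [p = a * 2 ^ n] with [a] odd, [p] steps translate by an odd multiple of
    [2 ^+ (k + n)] modulo [2 ^+ (k + n).+1]. *)
Lemma odometer_aperiodic p x : S x -> (0 < p)%N -> iter p h x <> x.
Proof.
move=> Sx p0 hx; have [a oa pE] := pfactor_coprime (isT : prime 2) p0.
rewrite coprime2n in oa; set n := logn 2 p in pE.
have [shiftH _] := odometer_pow2 n; set H := iter (2 ^ n) h in shiftH.
have iterH j : cong (k + n).+1 (iter j H x) (x + (j * 2 ^ (k + n))%:R).
  elim: j => [|j IH]; first by rewrite mul0n addr0.
  have Sj : S (iter j H x).
    by rewrite -iterM; apply: S_sat (odometer_iter_sat _ Sx).
  rewrite iterS; apply: cong_trans (shiftH _ Sj) _.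
  by rewrite mulSnr natrD addrA natrX; apply: congD IH (cong_refl _ _).
have : cong (k + n).+1 (a * 2 ^ (k + n))%:R 0%:R.
  have := iterH a; rewrite -iterM -pE hx => /cong_sym/(congD (cong_refl _ (- x))).
  by rewrite addKr addNr.
move/cong_nat/eqP; rewrite mod0n -/(dvdn _ _) expnS dvdn_pmul2r ?expn_gt0 //.
by rewrite dvdn2 oa.
Qed.
End Odometer.

(** * The 2-adic topology *)

Lemma nbhs_congP (x : Z2) (U : set Z2) :
  nbhs x U <-> exists n, forall y, cong n x y -> U y.
Proof.
split=> [/nbhsP[E [n _ nE] EU]|[n nU]].
  by exists n => y xy; apply: EU; rewrite /xsection /= inE; apply: nE.
apply/nbhsP; exists [set xy | cong n xy.1 xy.2]; first by exists n.
by move=> y; rewrite /xsection /= inE => /nU.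
Qed.

Lemma closure_congP (A : set Z2) y :
  closure A y <-> forall n, exists2 a, A a & cong n a y.
Proof.
split=> [Ay n|Ay U /nbhs_congP[n nU]]; last first.
  by have [a Aa ay] := Ay n; exists a; split=> //; apply/nU/cong_sym.
have [|a [Aa ya]] := Ay [set z | cong n y z]; first by apply/nbhs_congP; exists n.
by exists a => //; apply: cong_sym.
Qed.

Lemma clopen_cong_sat n (A : set Z2) :
  (forall x y, A x -> cong n x y -> A y) -> clopen A.
Proof.
move=> satA; split; last by move=> y /closure_congP/(_ n)[a Aa /(satA _ _ Aa)].
by rewrite openE => x Ax; apply/nbhs_congP; exists n => y; apply: satA.
Qed.

Lemma coset2P (a : Z2) n x : coset2 a n x <-> cong n x a.
Proof.
by split=> [[z _ <-]|/congP[w ->]]; [apply/congP; exists z|exists w].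
Qed.

(** Nonzero distances are powers of 2, so an open ball of radius 2^-n is a residue
    class modulo 2^(n+1). *)
Lemma ball_congP (R : realType) (a : Z2) n y :
  ball a (2 ^- n : R) y <-> cong n.+1 y a.
Proof.
have lt2 i j : (2 ^- i < 2 ^- j :> R) = (j < i)%N.
  by rewrite ltf_pV2 ?posrE ?exprn_gt0 // ltr_eXn2l ?ltr1n.
rewrite Z2_ballE /=; split=> [lt_ay|/cong_sym/eqP].
  apply: cong_sym; have [/Z2_dist_positivity -> //|[v ev]] := @Z2_dist_exp R a y.
  move: lt_ay; rewrite ev lt2 => nv; apply: cong_le nv _.
  by apply/eqP; rewrite -(@Z2_dist_le R) ev.
by rewrite -(@Z2_dist_le R) => /le_lt_trans; apply; rewrite lt2.
Qed.

Lemma two_cosets_balls (R : realType) (a b : Z2) n :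
  @finite_union_of_balls R Z2 (coset2 a n.+1 `|` coset2 b n.+1).
Proof.
exists 2%N, (fun i : 'I_2 => if i == 0 :> nat then a else b), (fun=> 2 ^- n).
split=> [i|]; first by rewrite invr_gt0 exprn_gt0.
apply/seteqP; split=> x.
  by case=> /coset2P xc; [exists ord0|exists ord_max] => //; apply/ball_congP.
by case=> i _; case: ifP => _ /ball_congP xc; [left|right]; apply/coset2P.
Qed.

(** * Dynamics on even and on odd points *)

Section Dynamics.
Variable d : nat.
Let F (x : Z2) : Z2 := (fibpoly Z2 (76 + 96 * d)).[x].

(** Modulo 2 the period is 3, and the index is 1 modulo 3. *)
Lemma F_odd x : odd2 x -> odd2 (F x).
Proof.
move=> ox; rewrite /F (_ : 76 + 96 * d = 1 + 3 * (25 + 32 * d))%N; last first.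
  by rewrite mulnDr mulnA addnA.
have [F0 F1] := fib3_mod2 ox.
by apply: cong_trans (fib_period F0 F1 1 _) _; rewrite fibpoly1 hornerC.
Qed.

(** With [y - x = 4 * u], the quadratic Taylor remainder contributes a factor
    divisible by 4 as well. *)
Lemma F_isometry x y : odd2 x -> cong 2 y x ->
  exists w, F y - F x = (y - x) * (1 + 4 * w).
Proof.
move=> ox /congP[u yx]; have [w Fy] := horner_taylor2 (fibpoly Z2 (76 + 96 * d)) x y.
have := @deriv_fib_mod4 x (6 + 8 * d) ox.
rewrite mulnDr mulnA addnA => /congP[v Dx].
exists (v + u * w); rewrite /F Fy Dx yx; ring.
Qed.

Let h := iter 2 F.

Lemma h_isometry x y : odd2 x -> cong 6 y x ->
  exists w, h y - h x = (y - x) * (1 + 4 * w).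
Proof.
move=> ox yx; have yx2 : cong 2 y x by apply: cong_le yx.
have [w Fyx] := F_isometry ox yx2.
have [v hyx] := F_isometry (F_odd ox) (cong_horner (fibpoly Z2 (76 + 96 * d)) yx2).
by exists (w + v + 4 * w * v); rewrite /h /= hyx Fyx; ring.
Qed.

Lemma iter_h j x : iter j h x = iter (j * 2) F x.
Proof. by rewrite iterM. Qed.

Lemma odd_dense n x y : odd2 x -> cong 6 y x -> exists j, cong n (iter j F x) y.
Proof.
move=> ox yx.
have sat u v : odd2 u -> cong 6 v u -> odd2 v by move=> ou /cong_odd2; apply.
have [j jxy] := odometer_dense sat (fib_fib_mod128 d) h_isometry n ox yx.
by exists (j * 2)%N; rewrite -iter_h; apply: cong_le jxy; apply: leq_addl.
Qed.

Lemma odd_aperiodic x : odd2 x -> ~ periodic_point F x.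
Proof.
move=> ox [p p0 px].
have sat u v : odd2 u -> cong 6 v u -> odd2 v by move=> ou /cong_odd2; apply.
apply: (odometer_aperiodic sat (fib_fib_mod128 d) h_isometry ox p0).
by rewrite iter_h mulnC iterM /= !px.
Qed.

(** The half of the index is even, whence the factor 2. *)
Lemma F_even x : cong 1 x 0 -> exists w, F x = 2 * x * w.
Proof.
case/congP => z ->; have [w Fx] := @fib_even Z2 (38 + 48 * d) (0 + 2 ^+ 1 * z).
exists ((19 + 24 * d)%N%:R + z * w).
rewrite /F (_ : 76 + 96 * d = (38 + 48 * d).*2)%N; last first.
  by rewrite -mul2n mulnDr mulnA.
rewrite Fx (_ : 38 + 48 * d = 2 * (19 + 24 * d))%N; last by rewrite mulnDr mulnA.
rewrite natrM; ring.
Qed.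

Lemma F0 : F 0 = 0.
Proof. by have [w ->] := F_even (cong_refl 1 0); rewrite mulr0 mul0r. Qed.

Lemma iter_even n x : cong 1 x 0 -> cong n (iter n F x) 0.
Proof.
move=> ex; suff [w ->] : exists w, iter n F x = 2 ^+ n * x * w.
  by apply/congP; exists (x * w); rewrite add0r mulrA.
elim: n => [|n [w IH]]; first by exists 1; rewrite expr0 mul1r mulr1.
have [z xz] := (congP _ _ _).1 ex.
have /F_even[v Fv] : cong 1 (iter n F x) 0.
  by apply/congP; exists (2 ^+ n * z * w); rewrite IH xz; ring.
by exists (w * v); rewrite iterS Fv IH exprS; ring.
Qed.

(** An even periodic point returns to itself after arbitrarily many steps, so it
    is divisible by all powers of 2. *)
Lemma periodic_eq0 x : periodic_point F x -> x = 0.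
Proof.
move=> px; have [ex|ox] := even_or_odd x; last by have := odd_aperiodic ox px.
have [p p0 {}px] := px; apply: Z2P => n; rewrite -/(cong n x 0).
have <- : iter (n * p) F x = x by rewrite iterM; elim: n => //= n ->.
by apply: cong_le (leq_pmulr n p0) (iter_even _ ex).
Qed.

End Dynamics.

(** * The cells M_k *)

Definition cell (k : nat) : set Z2 :=
  [set x | cong 6 x (rep1 k)%:R \/ cong 6 x (rep3 k)%:R].

Lemma cell_coset k : cell k = coset2 (rep1 k)%:R 6 `|` coset2 (rep3 k)%:R 6.
Proof. by apply/seteqP; split=> x [] /coset2P xk; [left|right|left|right]. Qed.

Lemma cell_sat k x y : cell k x -> cong 6 x y -> cell k y.
Proof.
by move=> cx xy; case: cx => xk; [left|right]; apply: cong_trans (cong_sym xy) xk.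
Qed.

Lemma cell_odd k x : cell k x -> odd2 x.
Proof. by case=> /cong_odd2; apply; apply/odd2_nat; [apply: odd_rep1|apply: odd_rep3]. Qed.

(** Since 19 + 20 k + 16 k^2 = 3 + 4 (4 + 5 k + 4 k^2), and k |-> 5 k + 4 k^2 is
    injective modulo 16, the 32 representatives exhaust the odd residues modulo
    64; the proof enumerates them. *)
Lemma cell_cover x : odd2 x -> exists k : 'I_(2 ^ 4), cell k x.
Proof.
move=> ox; have [r r64 xr] := cong_natE 6 x.
have chk : all (fun r => odd r ==> has (fun k => (r == rep1 k %[mod 2 ^ 6]) ||
    (r == rep3 k %[mod 2 ^ 6])) (iota 0 (2 ^ 4))) (iota 0 (2 ^ 6)) by vm_compute.
move/allP/(_ r): chk; rewrite mem_iota => /(_ r64)/implyP.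
have /[swap]/[apply] : odd r by apply/odd2_nat; apply: cong_odd2 (cong_sym xr) ox.
case/hasP => k; rewrite mem_iota => /= k16 rk; exists (Ordinal k16).
by case/orP: rk => /eqP/cong_nat rk; [left|right]; apply: cong_trans xr rk.
Qed.

Lemma cell_inj (i j : 'I_(2 ^ 4)) x : cell i x -> cell j x -> i = j.
Proof.
have chk : all (fun i => all (fun j => has (fun f => has (fun g =>
    f i == g j %[mod 2 ^ 6]) [:: rep1; rep3]) [:: rep1; rep3] ==> (i == j))
    (iota 0 (2 ^ 4))) (iota 0 (2 ^ 4)) by vm_compute.
move=> xi xj; apply/val_inj/eqP.
move/allP/(_ i): chk; rewrite mem_iota => /(_ (ltn_ord i))/allP/(_ j).
rewrite mem_iota => /(_ (ltn_ord j))/implyP; apply.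
have E u v : cong 6 x u%:R -> cong 6 x v%:R -> u == v %[mod 2 ^ 6].
  by move=> xu xv; apply/eqP/cong_nat; apply: cong_trans (cong_sym xu) xv.
by case: xi => xi; case: xj => xj; rewrite /= (E _ _ xi xj) ?orbT.
Qed.

Section Cells.
Variable d : nat.
Let F (x : Z2) : Z2 := (fibpoly Z2 (76 + 96 * d)).[x].

Lemma cell_F (k : 'I_(2 ^ 4)) x : cell k x -> cell k (F x).
Proof.
have [F1 F3] := fib_mod64 d (ltn_ord k).
by case=> xk; [right; apply: F1|left; apply: F3].
Qed.

(** If [x] and [y] lie in different cosets of the cell, one application of F
    brings [x] into the coset of [y]. *)
Lemma cell_dense (k : 'I_(2 ^ 4)) n x y : cell k x -> cell k y ->
  exists j, cong n (iter j F x) y.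
Proof.
move=> cx cy; have ox := cell_odd cx.
suff [yx|yx] : cong 6 y x \/ cong 6 y (F x); first exact: odd_dense.
  have [j jy] := odd_dense d n (F_odd d ox) yx.
  by exists j.+1; rewrite iterSr.
have [F1 F3] := fib_mod64 d (ltn_ord k).
case: cx cy => xk [] yk.
- by left; apply: cong_trans yk (cong_sym xk).
- by right; apply: cong_trans yk (cong_sym (F1 _ xk)).
- by right; apply: cong_trans yk (cong_sym (F3 _ xk)).
- by left; apply: cong_trans yk (cong_sym xk).
Qed.

Lemma closure_orbit_cell (k : 'I_(2 ^ 4)) x : cell k x ->
  closure (forward_orbit F x) = cell k.
Proof.
move=> cx; apply/seteqP; split=> y.
  move/closure_congP/(_ 6) => [_ [n _ <-] ny]; apply: cell_sat ny.
  by elim: n => //= n; apply: cell_F.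
move=> cy; apply/closure_congP => n; have [j jy] := cell_dense n cx cy.
by exists (iter j F x) => //; exists j.
Qed.

Lemma cell_minimal (R : realType) (k : 'I_(2 ^ 4)) : @minimal_component R Z2 F (cell k).
Proof.
split.
- by exists (rep1 k)%:R; left.
- by apply: (@clopen_cong_sat 6) => x y; apply: cell_sat.
- by rewrite cell_coset; apply: two_cosets_balls.
- by move=> _ [x cx <-]; apply: cell_F.
- by move=> x cx; rewrite (closure_orbit_cell cx).
Qed.

(** Closedness and invariance of C give one inclusion, density of the orbits the
    other. *)
Lemma minimal_component_closure (R : realType) (C : set Z2) x :
  @minimal_component R Z2 F C -> C x -> closure (forward_orbit F x) = C.
Proof.
move=> [_ [_ clC] _ FC dC] Cx; apply/seteqP; split; last exact: dC.
move=> y /closure_congP yx; apply: clC; apply/closure_congP => n.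
have [_ [j _ <-] jy] := yx n; exists (iter j F x) => //.
by elim: j {jy} => //= j IH; apply: FC; exists (iter j F x).
Qed.

(** An even point of C would force C = {0}, although every neighbourhood of 0
    contains some nonzero [2 ^+ n]. *)
Lemma minimal_component_cell (R : realType) (C : set Z2) :
  @minimal_component R Z2 F C -> exists k : 'I_(2 ^ 4), C = cell k.
Proof.
move=> mC; have [[x Cx] [opC _] _ _ _] := mC.
have [ex|ox] := even_or_odd x; last first.
  have [k cx] := cell_cover ox; exists k.
  by rewrite -(minimal_component_closure mC Cx) (closure_orbit_cell cx).
have C0 : C 0.
  rewrite -(minimal_component_closure mC Cx); apply/closure_congP => n.
  by exists (iter n F x); [exists n|apply: iter_even].
have Ceq0 y : C y -> y = 0.
  rewrite -(minimal_component_closure mC C0) => /closure_congP y0.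
  apply: Z2P => n; have [_ [j _ <-] <-] := y0 n.
  by congr residue; elim: j => //= j ->; apply: F0.
have /nbhs_congP[n nC] : nbhs (0 : Z2) C by apply: open_nbhs_nbhs; split.
have /Ceq0 : C (2 ^+ n).
  by apply: nC; apply: cong_sym; apply/congP; exists 1; rewrite add0r mulr1.
rewrite -natrX => /(congr1 (residue^~ n.+1)).
rewrite -[RHS]/(residue 0%:R n.+1) => /cong_nat/eqP.
by rewrite mod0n modn_small ?ltn_exp2l // expn_eq0.
Qed.

Lemma even_basin (R : realType) x : cong 1 x 0 -> @attracting_basin R Z2 F [set 0] x.
Proof.
move=> ex; rewrite /attracting_basin /=.
rewrite (_ : (fun n => _) = (fun n => Z2_dist (iter n F x) 0 : R)); last first.
  by apply/funext => n; rewrite /dist_to_set image_set1 inf1.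
apply: (@squeeze_cvgr _ _ _ _ (fun=> 0) (fun n => 2^-1 ^+ n)).
- apply: nearW => n; rewrite Z2_dist_ge0 exprVn Z2_dist_le; apply/eqP.
  exact: (iter_even d n ex).
- exact: (@cvg_cst R^o).
- by apply: cvg_expr; rewrite ger0_norm ?invr_ge0 // invf_lt1 ?ltr1n.
Qed.

End Cells.

(** * The minimal decomposition *)

Unset Implicit Arguments.

Theorem theorem6p7 (R : realType) (d q m : nat)
    (hq : q = (6 + 8 * d)%N) (hm : m = (4 + 12 * q)%N) :
  let F : {poly Z2} := fibpoly Z2 m in
  let M (k : 'I_(2 ^ 4)) : set Z2 :=
    coset2 (1 + 4 * k)%:R 6 `|` coset2 (19 + 20 * k + 16 * k ^ 2)%:R 6 in
  let B : set Z2 := [set 2 * z | z in [set: Z2]] `\ 0 in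
  [/\ minimal_decomposition R F [set 0] [set: 'I_(2 ^ 4)] M B,
      F.[0] = 0 &
      forall x, B x -> attracting_basin R (horner F) [set 0] x].
Proof.
have {q hq hm} -> : m = (76 + 96 * d)%N by rewrite hm hq mulnDr mulnA addnA.
move=> F M B.
have ME k : M k = cell k by rewrite cell_coset.
have BE x : B x <-> cong 1 x 0 /\ x <> 0.
  split=> [[[z _ <-] z0]|[/congP[w ->] x0]]; split=> //.
    by apply/congP; exists z; rewrite add0r expr1.
  by exists w => //; rewrite add0r expr1.
have basin x : B x -> attracting_basin R (horner F) [set 0] x.
  by case/BE => ex _; exact: (@even_basin d R x ex).
have even_odd x : cong 1 x 0 -> ~ odd2 x by rewrite /odd2 /cong => ->.
have per0 : periodic_point (horner F) 0 by exists 1%N => //; exact: (F0 d).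
split=> //; last exact: (F0 d).
split.
- split.
  + apply/seteqP; split=> // x _; have [ex|ox] := even_or_odd x.
      by have [->|/eqP x0] := eqVneq x 0; [left; left|right; apply/BE].
    by have [k cx] := cell_cover ox; left; right; exists k; rewrite ?ME.
  + apply/seteqP; split=> // x [-> [k _]]; rewrite ME => /cell_odd.
    exact: even_odd.
  + by apply/seteqP; split=> // x [-> /BE[]].
  + apply/seteqP; split=> // x [[k _]]; rewrite ME => /cell_odd ox /BE[ex _].
    exact: even_odd ex ox.
- split; first exact: finite_set1.
  by apply/seteqP; split=> [x ->|x /(@periodic_eq0 d)].
- split; first exact: countableP.
  move=> i j _ _ [x []]; rewrite !ME; exact: cell_inj.
- move=> C; split=> [/(@minimal_component_cell d)[k ->]|[k _ ->]].
    by exists k; rewrite ?ME.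
  by rewrite ME; exact: (cell_minimal d R k).
- move=> x Bx; exists [set 0]; last exact: basin.
  left; exists 0 => //; apply/seteqP; split=> [_ ->|_ [n _ <-]].
    by exists 0%N.
  by elim: n => //= n ->; exact: (F0 d).
Qed.
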